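(* Let $n,k\ge 1$ and let $Q_1,\dots,Q_k\in\mathbb{R}^{n\times n}$ be symmetric positive definite matrices. Let $\mathcal{H}=\bigoplus_{i=1}^k\mathcal{E}(Q_i)$ be the geometric (Minkowski) sum of the corresponding ellipsoids. Then the boundary of $\mathcal{H}$ is exactly $$\partial\mathcal{H}=\left\{\sum_{i=1}^{k}\langle \ell,Q_i\ell\rangle^{-\frac12}Q_i\ell\ \Big|\ \ell\in\mathbb{R}^n,\ \|\ell\|=1\right\}.$$
   Context: For a symmetric positive definite matrix $Q\in\mathbb{R}^{n\times n}$, $\mathcal{E}(Q)=\{\xi\in\mathbb{R}^n : \xi^TQ^{-1}\xi\le 1\}$ is the ellipsoid centered at the origin with shape matrix $Q$. The geometric (Minkowski) sum of sets $\mathcal{S}_1,\dots,\mathcal{S}_k\subset\mathbb{R}^n$ is $\bigoplus_{i=1}^k\mathcal{S}_i=\{s_1+\cdots+s_k : s_i\in\mathcal{S}_i\}$. $\langle\cdot,\cdot\rangle$ is the Euclidean inner product and $\|\cdot\|$ the Euclidean norm. *)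

(* Defs.v *)
From HB Require Import structures.
From mathcomp Require Import all_boot all_order all_algebra.
From mathcomp Require Import all_classical all_reals all_analysis.

Set Implicit Arguments.
Unset Strict Implicit.
Unset Printing Implicit Defensive.

Import Order.TTheory GRing.Theory Num.Theory.
Import numFieldNormedType.Exports.

Local Open Scope classical_set_scope.
Local Open Scope ring_scope.

Definition dotprod (R : realType) (n : nat) (u v : 'cV[R]_n) : R :=
  \sum_(i < n) u i 0 * v i 0.

(* The library norm on matrices is the maximum norm, hence this one. *)
Definition enorm (R : realType) (n : nat) (u : 'cV[R]_n) : R :=
  Num.sqrt (dotprod u u).

Definition symposdef (R : realType) (n : nat) (Q : 'M[R]_n) : Prop :=
  Q^T = Q /\ forall x : 'cV[R]_n, x != 0 -> 0 < (x^T *m Q *m x) 0 0.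

Definition ellipsoid (R : realType) (n : nat) (Q : 'M[R]_n) : set 'cV[R]_n :=
  [set x | (x^T *m invmx Q *m x) 0 0 <= 1].

Definition minkowski_sum (R : realType) (n k : nat)
    (S : 'I_k -> set 'cV[R]_n) : set 'cV[R]_n :=
  [set x | exists2 s : 'I_k -> 'cV[R]_n,
             (forall i, S i (s i)) & x = \sum_(i < k) s i].

(* On column vectors, closure and interior refer to the entrywise (product)
   topology of the library, which is the Euclidean topology. *)
Definition boundary (T : topologicalType) (A : set T) : set T :=
  closure A `\` interior A.

(* Main.v *)
(** Each ellipsoid E(Q) lies in the half-space <l,s> <= <l,Ql>^(1/2), touching its
    boundary only at <l,Ql>^(-1/2) Ql (Cauchy-Schwarz for the form of Q). Summing,
    the Minkowski sum H has support function h(l) = sum_i <l,Q_i l>^(1/2), attained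
    only at y(l) = sum_i <l,Q_i l>^(-1/2) Q_i l. So y(l) is not interior to H.
    Conversely, let x in H differ from every y(l). Then h(l) - <l,x> is positive on
    the unit sphere, hence bounded below there by some c > 0, so <l,z> < h(l)
    for all unit l and all z near x. Since H is compact and convex, a point outside H
    is strictly separated from H, namely from y(l), by some unit l; hence all those z
    lie in H and x is interior. *)
Require Import Defs.
From HB Require Import structures.
From mathcomp Require Import all_boot all_order all_algebra.
From mathcomp Require Import all_classical all_reals all_analysis.
From mathcomp Require Import ring lra.

Import Order.TTheory GRing.Theory Num.Theory.
Import numFieldNormedType.Exports.

Local Open Scope classical_set_scope.
Local Open Scope ring_scope.

(** * Entrywise continuity and compactness for column vectors *)

Lemma continuous_mx (T U : topologicalType) m n (f : T -> 'M[U]_(m, n)) :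
  (forall i j, continuous (fun x => f x i j)) -> continuous f.
Proof.
move=> cf x A [P xP PA]; apply: (filterS PA).
apply: filter_forall => i; apply: filter_forall => j.
exact: (cf i j x _ (xP i j)).
Qed.

Lemma mx_coord_continuous (T : topologicalType) m n i j :
  continuous (fun M : 'M[T]_(m, n) => M i j).
Proof.
move=> M A MA.
exists (fun i' j' => if (i' == i) && (j' == j) then A else setT).
  move=> i' j' /=; case: ifP => [/andP[/eqP-> /eqP->]//|_].
  exact: filterT.
by move=> N /(_ i j); rewrite /= !eqxx.
Qed.

(** Tychonoff for row vectors, transported along the continuous transpose. *)
Lemma cV_compact (T : ptopologicalType) n (A : 'I_n -> set T) :
  (forall i, compact (A i)) -> compact [set v : 'cV[T]_n | forall i, A i (v i 0)].
Proof.
move=> cA; rewrite (_ : mkset _ =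
    trmx @` [set v : 'rV[T]_n | forall i, A i (v ord0 i)]).
  apply: continuous_compact (rV_compact cA).
  apply: continuous_subspaceT; apply: continuous_mx => i j.
  rewrite (_ : (fun _ => _) = fun x : 'rV[T]_n => x j i).
    exact: mx_coord_continuous.
  by apply/funext => x; rewrite mxE.
apply/seteqP; split => [v Av | _ [v Av <-] i]; last by rewrite mxE; exact: Av.
by exists v^T; [move=> i; rewrite mxE | rewrite trmxK].
Qed.

Lemma coord_bounded_closed_compact (R : realType) n (A : set 'cV[R]_n) :
  closed A -> (forall i, exists M, forall v, A v -> `|v i 0| <= M) ->
  compact A.
Proof.
move=> clA /choice[M AM].
have cB : compact [set v : 'cV[R]_n | forall i, `[- M i, M i]%classic (v i 0)].
  apply: (@cV_compact R _ (fun i => `[- M i, M i]%classic)) => i.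
  exact: segment_compact.
apply: subclosed_compact clA cB _ => v Av i /=.
by rewrite in_itv /= -ler_norml; exact: AM.
Qed.

Lemma sumr_continuous (R : realType) (T : topologicalType) (k : nat)
    (f : 'I_k -> T -> R) :
  (forall i, continuous (f i)) -> continuous (fun x => \sum_(i < k) f i x).
Proof.
move=> cf; apply: continuous_big => [|i _]; last exact: cf.
exact: add_continuous.
Qed.

(** The sum is the image of the product of the [S i] under the continuous addition map. *)
Lemma minkowski_sum_compact (R : realType) n k (S : 'I_k -> set 'cV[R]_n) :
  (forall i, compact (S i)) -> compact (minkowski_sum S).
Proof.
move=> cS; pose f (v : 'rV['cV[R]_n]_k) : 'cV[R]_n := \sum_i v ord0 i.
rewrite (_ : minkowski_sum S = f @` [set v : 'rV['cV[R]_n]_k | forall i, S i (v ord0 i)]).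
  apply: continuous_compact (rV_compact cS).
  apply: continuous_subspaceT; apply: continuous_mx => i j.
  under eq_fun do rewrite summxE.
  apply: sumr_continuous => a v.
  apply: (@continuous_comp _ _ _ (fun v : 'rV['cV[R]_n]_k => v ord0 a)
    (fun u : 'cV[R]_n => u i j)); exact: mx_coord_continuous.
apply/seteqP; split => [_ [s Ss ->] | _ [v Sv <-]]; last by exists (v ord0).
exists (\row_i s i) => [i|]; first by rewrite mxE.
by apply: eq_bigr => i _; rewrite mxE.
Qed.

(** * Inner product, quadratic forms, and separation from a compact convex set *)

Section InnerProduct.
Context {R : realType} {n : nat}.
Implicit Types (u v w : 'cV[R]_n) (Q : 'M[R]_n) (a : R).

Lemma dotprodE u v : dotprod u v = (u^T *m v) 0 0.
Proof. by rewrite mxE; apply: eq_bigr => i _; rewrite mxE. Qed.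

Lemma dotprodC u v : dotprod u v = dotprod v u.
Proof. by apply: eq_bigr => i _; rewrite mulrC. Qed.

Lemma dotprodDr u v w : dotprod u (v + w) = dotprod u v + dotprod u w.
Proof. by rewrite !dotprodE mulmxDr mxE. Qed.

Lemma dotprodDl u v w : dotprod (u + v) w = dotprod u w + dotprod v w.
Proof. by rewrite !(dotprodC _ w) dotprodDr. Qed.

Lemma dotprodZr a u v : dotprod u (a *: v) = a * dotprod u v.
Proof. by rewrite !dotprodE -scalemxAr mxE. Qed.

Lemma dotprodZl a u v : dotprod (a *: u) v = a * dotprod u v.
Proof. by rewrite !(dotprodC _ v) dotprodZr. Qed.

Lemma dotprodBr u v w : dotprod u (v - w) = dotprod u v - dotprod u w.
Proof. by rewrite dotprodDr -scaleN1r dotprodZr mulN1r. Qed.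

Lemma dotprod_sumr k u (f : 'I_k -> 'cV[R]_n) :
  dotprod u (\sum_i f i) = \sum_i dotprod u (f i).
Proof.
by rewrite dotprodE mulmx_sumr summxE; apply: eq_bigr => i _; rewrite dotprodE.
Qed.

Lemma dotprod_delta i u : dotprod (delta_mx i 0) u = u i 0.
Proof.
rewrite /dotprod (bigD1 i) //= big1 => [|j /negPf ji].
  by rewrite mxE !eqxx mul1r addr0.
by rewrite mxE ji mul0r.
Qed.

Lemma dotprod_sym Q u v : Q^T = Q -> dotprod u (Q *m v) = dotprod v (Q *m u).
Proof. by move=> Qs; rewrite dotprodC !dotprodE trmx_mul Qs mulmxA. Qed.

Lemma quadformE Q u : (u^T *m Q *m u) 0 0 = dotprod u (Q *m u).
Proof. by rewrite dotprodE mulmxA. Qed.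

Lemma quadformZ Q a u :
  dotprod (a *: u) (Q *m (a *: u)) = a ^+ 2 * dotprod u (Q *m u).
Proof. by rewrite -scalemxAr dotprodZl dotprodZr mulrA. Qed.

Lemma quadformD Q a u v : Q^T = Q ->
  dotprod (u + a *: v) (Q *m (u + a *: v)) =
  dotprod u (Q *m u) + 2 * a * dotprod u (Q *m v)
  + a ^+ 2 * dotprod v (Q *m v).
Proof.
move=> Qs; rewrite mulmxDr -scalemxAr !dotprodDl !dotprodDr !dotprodZl !dotprodZr.
by rewrite (dotprod_sym Q v u Qs); ring.
Qed.

Lemma sqnormD a u v :
  dotprod (u + a *: v) (u + a *: v) =
  dotprod u u + 2 * a * dotprod u v + a ^+ 2 * dotprod v v.
Proof. by have := quadformD 1%:M a u v (trmx1 _ _); rewrite !mul1mx. Qed.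

Lemma sqnorm_ge0 u : 0 <= dotprod u u.
Proof. by apply: sumr_ge0 => i _; exact: sqr_ge0. Qed.

Lemma sqnorm_eq0 u : (dotprod u u == 0) = (u == 0).
Proof.
apply/idP/eqP => [|->]; last by rewrite /dotprod big1 // => i _; rewrite mxE mul0r.
rewrite psumr_eq0 => [/allP u0|i _]; last exact: sqr_ge0.
apply/colP => i; rewrite mxE; apply/eqP.
by have := u0 i; rewrite mem_index_enum mulf_eq0 orbb => /(_ isT).
Qed.

Lemma sqnorm_gt0 u : u != 0 -> 0 < dotprod u u.
Proof. by rewrite lt0r sqnorm_ge0 sqnorm_eq0 => ->. Qed.

Lemma enorm1_sqnorm u : (enorm u = 1) <-> (dotprod u u = 1).
Proof.
rewrite /enorm; split => [u1|->]; last exact: sqrtr1.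
by rewrite -(sqr_sqrtr (sqnorm_ge0 u)) u1 expr1n.
Qed.

Lemma enorm1_neq0 u : enorm u = 1 -> u != 0.
Proof.
by move=> /enorm1_sqnorm u1; rewrite -sqnorm_eq0 u1 oner_neq0.
Qed.

Lemma enorm1_coord_le u i : enorm u = 1 -> `|u i 0| <= 1.
Proof.
move=> /enorm1_sqnorm u1; rewrite -(ler_pXn2r (ltn0Sn 1)) ?nnegrE //.
rewrite expr1n -u1 real_normK ?num_real // /dotprod (bigD1 i) //= expr2 lerDl.
by apply: sumr_ge0 => j _; exact: sqr_ge0.
Qed.

Lemma dotprod_continuous (T : topologicalType) (f g : T -> 'cV[R]_n) :
  continuous f -> continuous g -> continuous (fun x => dotprod (f x) (g x)).
Proof.
have coord (h : T -> 'cV[R]_n) i :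
    continuous h -> continuous (fun x => h x i 0).
  move=> ch x; apply: (@continuous_comp _ _ _ h (fun u : 'cV[R]_n => u i 0)).
    exact: ch.
  exact: mx_coord_continuous.
by move=> cf cg; apply: sumr_continuous => i x; apply: continuousM; exact: coord.
Qed.

Lemma mulmx_continuous Q : continuous (fun u : 'cV[R]_n => Q *m u).
Proof.
apply: (@continuous_mx _ R) => i j; under eq_fun do rewrite mxE.
apply: sumr_continuous => k x; apply: continuousM; first exact: cst_continuous.
exact: mx_coord_continuous.
Qed.

Lemma quadform_continuous Q : continuous (fun u => dotprod u (Q *m u)).
Proof.
apply: dotprod_continuous; first by move=> x; exact: cvg_id.
exact: mulmx_continuous.
Qed.

Lemma sphere_compact : compact [set u : 'cV[R]_n | enorm u = 1].
Proof.
apply: coord_bounded_closed_compact => [|i].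
  rewrite (_ : mkset _ = (fun u => dotprod u u) @^-1` [set 1]).
    apply: closed_comp; last exact: closed_eq.
    by move=> u _; apply: dotprod_continuous => x; exact: cvg_id.
  by apply/seteqP; split => u /enorm1_sqnorm.
by exists 1 => u; exact: enorm1_coord_le.
Qed.

(** The direction is [z - p], normalised, where [p] is a point of [A] nearest to [z]. *)
Lemma separating_direction (A : set 'cV[R]_n) (z : 'cV[R]_n) :
  A !=set0 -> compact A ->
  (forall u v (t : R), A u -> A v -> 0 <= t <= 1 -> A (u + t *: (v - u))) ->
  ~ A z -> exists2 l, enorm l = 1 & forall y, A y -> dotprod l y < dotprod l z.
Proof.
move=> A0 cA convA Az.
have [|p /set_mem Ap pmin] :=
    @compact_EVT_min _ R (fun y : 'cV[R]_n => dotprod (z - y) (z - y)) A A0 cA.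
  apply: continuous_subspaceT.
  have cB : continuous (fun y : 'cV[R]_n => z - y).
    apply: (@continuous_mx _ R) => i j; under eq_fun do rewrite !mxE.
    move=> y; apply: continuousB; first exact: cst_continuous.
    exact: mx_coord_continuous.
  exact: dotprod_continuous.
have zp0 : z - p != 0 by rewrite subr_eq0; apply/eqP => zp; apply: Az; rewrite zp.
have obtuse y : A y -> dotprod (z - p) (y - p) <= 0.
  (* Otherwise moving from [p] towards [y] by [t = a / (a + b)] comes closer to [z]. *)
  move=> Ay; rewrite leNgt; apply/negP => a_gt0.
  set a := dotprod _ _ in a_gt0.
  have b_ge0 := sqnorm_ge0 (y - p); set b := dotprod _ _ in b_ge0.
  have ab_gt0 : 0 < a + b by rewrite ltr_wpDr.
  pose t := a / (a + b).
  have t_gt0 : 0 < t by rewrite divr_gt0.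
  have t_le1 : t <= 1 by rewrite ler_pdivrMr // mul1r lerDl.
  have /mem_set/pmin : A (p + t *: (y - p)) by apply: convA => //; rewrite ltW.
  (* Minimality of [p] reads [0 <= - 2 a t + t^2 b]. Dividing by [t] gives [2 a <= t b], against
     [t b <= a] and [0 < a]. *)
  rewrite opprD addrA -scaleNr sqnormD -/a -/b.
  have -> : 2 * - t * a = - (2 * a) * t by ring.
  rewrite sqrrN -addrA lerDl expr2 -mulrA [t * (t * b)]mulrC -mulrDl pmulr_lge0 //.
  have : t * b <= a.
    by rewrite /t mulrAC ler_pdivrMr // ler_pM2l // lerDr ltW.
  by move: a_gt0; lra.
have r_gt0 : 0 < enorm (z - p) by rewrite sqrtr_gt0 sqnorm_gt0.
exists ((enorm (z - p))^-1 *: (z - p)).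
  apply/enorm1_sqnorm; rewrite dotprodZl dotprodZr mulrA -invfM -expr2.
  by rewrite sqr_sqrtr ?sqnorm_ge0 // mulVf // sqnorm_eq0.
move=> y /obtuse yp; rewrite !dotprodZl ltr_pM2l ?invr_gt0 //.
(* This difference is the squared norm of [z - p], so with [yp] the values at [y], [p], [z] satisfy
   [y <= p < z]. *)
have : 0 < dotprod (z - p) z - dotprod (z - p) p.
  by rewrite -dotprodBr sqnorm_gt0.
by move: yp; rewrite dotprodBr; lra.
Qed.

End InnerProduct.

(** * A single ellipsoid: support function, convexity, compactness *)

Section Ellipsoid.
Context {R : realType} {n : nat} {Q : 'M[R]_n}.
Hypothesis hQ : symposdef Q.
Implicit Types (u v w l s : 'cV[R]_n).

Lemma quadform_gt0 u : u != 0 -> 0 < dotprod u (Q *m u).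
Proof. by rewrite -quadformE; exact: hQ.2. Qed.

Lemma quadform_ge0 u : 0 <= dotprod u (Q *m u).
Proof.
by have [->|/quadform_gt0/ltW//] := eqVneq u 0; rewrite mulmx0 sqnorm_ge0.
Qed.

Lemma quadform_le0 u : dotprod u (Q *m u) <= 0 -> u = 0.
Proof.
by apply: contraTeq => /quadform_gt0; rewrite ltNge.
Qed.

(** By symmetry a row of the left kernel, transposed, is sent to 0 by [Q]. The form vanishes there,
    so the row is 0. *)
Lemma symposdef_unitmx : Q \in unitmx.
Proof.
rewrite -row_free_unit -kermx_eq0; apply/eqP/row_matrixP => i; rewrite row0.
apply/trmx_inj; rewrite trmx0; apply: quadform_le0.
have -> : Q *m (row i (kermx Q))^T = 0.
  by rewrite -{1}hQ.1 -trmx_mul -row_mul mulmx_ker row0 trmx0.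
by rewrite /dotprod big1 // => j _; rewrite [X in _ * X]mxE mulr0.
Qed.

(** Substituting [x = Q y] turns the form of the inverse at [x] into the form of [Q] at [y]. *)
Lemma symposdef_invmx : symposdef (invmx Q).
Proof.
split; first by rewrite trmx_inv hQ.1.
move=> x x0; rewrite quadformE dotprodC.
rewrite -{2}[x](mulKVmx symposdef_unitmx) quadform_gt0 //.
apply: contraNneq x0 => Qx0.
by rewrite -[x](mulKVmx symposdef_unitmx) Qx0 mulmx0.
Qed.

Lemma ellipsoidE s : ellipsoid Q s = (dotprod s (invmx Q *m s) <= 1) :> Prop.
Proof. by rewrite /ellipsoid /= quadformE. Qed.

Lemma ellipsoid_mulmx u : ellipsoid Q (Q *m u) <-> dotprod u (Q *m u) <= 1.
Proof. by rewrite ellipsoidE mulKmx ?symposdef_unitmx // dotprodC. Qed.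

Lemma ellipsoid_support l s : l != 0 -> ellipsoid Q s ->
  dotprod l s <= Num.sqrt (dotprod l (Q *m l))
    ?= iff (s == (Num.sqrt (dotprod l (Q *m l)))^-1 *: (Q *m l)).
Proof.
move=> /quadform_gt0 l_gt0; rewrite -[s](mulKVmx symposdef_unitmx).
move: (invmx Q *m s) => w /ellipsoid_mulmx w_le1.
(* With [s = Q w] and [r^2 = l^T Q l], expand [0 <= q(w - l / r)] for the form [q]
   of [Q], using [q(w) <= 1]; it vanishes only when [s = Q l / r]. *)
set r := Num.sqrt _.
have r_gt0 : 0 < r by rewrite sqrtr_gt0.
have r2 : r ^+ 2 = dotprod l (Q *m l) by rewrite sqr_sqrtr ?ltW.
pose d := w - r^-1 *: l.
have qd : dotprod d (Q *m d) =
    dotprod w (Q *m w) - 2 * (r^-1 * dotprod l (Q *m w)) + 1.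
  rewrite /d -scaleNr quadformD ?hQ.1 // (dotprod_sym _ w l hQ.1) -r2.
  by field; rewrite gt_eqF.
apply/leifP; case: eqP => [->|wl].
  by rewrite dotprodZr -r2 expr2 mulKf // gt_eqF.
rewrite ltNge; apply/negP => r_le; apply: wl.
have : 1 <= r^-1 * dotprod l (Q *m w).
  by rewrite mulrC ler_pdivlMr // mul1r.
move=> ge1; have /quadform_le0/eqP : dotprod d (Q *m d) <= 0.
  by rewrite qd; move: w_le1 ge1; lra.
by rewrite subr_eq0 => /eqP->; rewrite -scalemxAr.
Qed.

Lemma ellipsoid_support_point l : l != 0 ->
  ellipsoid Q ((Num.sqrt (dotprod l (Q *m l)))^-1 *: (Q *m l)).
Proof.
move=> /quadform_gt0 l_gt0; rewrite scalemxAr; apply/ellipsoid_mulmx.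
by rewrite quadformZ exprVn sqr_sqrtr ?(ltW l_gt0) // mulVf ?(gt_eqF l_gt0).
Qed.

Lemma ellipsoid_convex u v (t : R) : ellipsoid Q u -> ellipsoid Q v ->
  0 <= t <= 1 -> ellipsoid Q (u + t *: (v - u)).
Proof.
rewrite !ellipsoidE => qu qv /andP[t0 t1]; have Pi := symposdef_invmx.
(* Writing [v] as the point at time 1 lets [quadformD] expand both [q(v)] and the form at time [t]
   in the same [a], [b], [c]. *)
have vE : u + 1 *: (v - u) = v by rewrite scale1r addrC subrK.
have : 0 <= dotprod (v - u) (invmx Q *m (v - u)).
  have [->|/Pi.2] := eqVneq (v - u) 0; first by rewrite mulmx0 sqnorm_ge0.
  by rewrite quadformE => /ltW.
move: qu qv; rewrite -{1 2}vE !quadformD ?Pi.1 //.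
set a := dotprod u (_ *m u); set b := dotprod u (_ *m (v - u)).
set c := dotprod _ _ => a1 abc c0.
(* The convexity identity [q(u + t(v - u)) = (1 - t) q(u) + t q(v) - t(1 - t) q(v - u)]. *)
have -> : a + 2 * t * b + t ^+ 2 * c =
  (1 - t) * a + t * (a + 2 * 1 * b + 1 ^+ 2 * c) - t * (1 - t) * c by ring.
have s0 : 0 <= 1 - t by rewrite subr_ge0.
have := ler_wpM2l s0 a1; have := ler_wpM2l t0 abc.
have := mulr_ge0 (mulr_ge0 t0 s0) c0; rewrite !mulr1.
by lra.
Qed.

(** Closed as a sublevel set of a continuous form. The support bound in the directions [e] and [-e]
    bounds each coordinate. *)
Lemma ellipsoid_compact : compact (ellipsoid Q).
Proof.
apply: coord_bounded_closed_compact => [|i].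
  rewrite (_ : ellipsoid Q =
      (fun s => dotprod s (invmx Q *m s)) @^-1` [set x | x <= 1]).
    apply: closed_comp; last exact: closed_le.
    by move=> s _; exact: quadform_continuous.
  by apply/funext => s; rewrite ellipsoidE.
pose e : 'cV[R]_n := delta_mx i 0.
have e0 : e != 0.
  by apply/eqP => /matrixP/(_ i 0); rewrite !mxE !eqxx => /eqP; rewrite oner_eq0.
exists (Num.sqrt (dotprod e (Q *m e))) => s Qs.
rewrite ler_norml -dotprod_delta lerNl; apply/andP; split; last first.
  exact: (ellipsoid_support e s e0 Qs).1.
have Ne0 : -1 *: e != 0 by rewrite scaleN1r oppr_eq0.
have := (ellipsoid_support _ s Ne0 Qs).1.
by rewrite quadformZ sqrrN expr1n mul1r dotprodZl mulN1r.
Qed.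

End Ellipsoid.

(** * Support function, exterior and interior of the Minkowski sum *)

Section EllipsoidSum.
Context {R : realType} {n k : nat} {Q : 'I_k -> 'M[R]_n}.
Hypothesis hQ : forall i, symposdef (Q i).
Implicit Types (x l : 'cV[R]_n).

Local Notation H := (minkowski_sum (fun i => ellipsoid (Q i))).

Local Notation support l := (\sum_(i < k) Num.sqrt (dotprod l (Q i *m l))).

Local Notation support_point l :=
  (\sum_(i < k) (Num.sqrt (dotprod l (Q i *m l)))^-1 *: (Q i *m l)).

Lemma support_pointE l : support_point l =
  \sum_(i < k) (dotprod l (Q i *m l) `^ (- 2^-1)) *: (Q i *m l).
Proof.
by apply: eq_bigr => i _; rewrite powRN powR12_sqrt // quadform_ge0.
Qed.

(** The bounds for the summands add up, and equality of the sums forces equality in every summand,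
    which fixes each [s i]. *)
Lemma ellipsoid_sum_support l x : l != 0 -> H x ->
  dotprod l x <= support l ?= iff (x == support_point l).
Proof.
move=> l0 [s sE ->]; rewrite dotprod_sumr.
have leif_s := leif_sum (fun i (_ : true) => ellipsoid_support (hQ i) l _ l0 (sE i)).
split; first exact: leif_s.1.
apply/idP/eqP => [|sl].
  by rewrite leif_s.2 => /forallP sl; apply: eq_bigr => i _; exact/eqP/sl.
(* Conversely, each term of the support point attains the support value of its own ellipsoid. *)
rewrite -dotprod_sumr sl dotprod_sumr; apply/eqP/eq_bigr => i _.
have [_] := ellipsoid_support (hQ i) l _ l0 (ellipsoid_support_point (hQ i) l l0).
by rewrite eqxx => /eqP.
Qed.

Lemma ellipsoid_sum_support_point l : l != 0 -> H (support_point l).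
Proof.
move=> l0; exists (fun i => (Num.sqrt (dotprod l (Q i *m l)))^-1 *: (Q i *m l)).
  by move=> i; exact: ellipsoid_support_point.
by [].
Qed.

Lemma dotprod_support_point l : l != 0 -> dotprod l (support_point l) = support l.
Proof.
move=> l0; have [_] := ellipsoid_sum_support l _ l0 (ellipsoid_sum_support_point l l0).
by rewrite eqxx => /eqP.
Qed.

Lemma ellipsoid_sum_convex u v (t : R) : H u -> H v -> 0 <= t <= 1 ->
  H (u + t *: (v - u)).
Proof.
move=> [s sE ->] [s' s'E ->] t01.
exists (fun i => s i + t *: (s' i - s i)) => [i|].
  exact: ellipsoid_convex.
by rewrite big_split /= -scaler_sumr sumrB.
Qed.

Lemma ellipsoid_sum_compact : compact H.
Proof. by apply: minkowski_sum_compact => i; exact: ellipsoid_compact. Qed.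

(** A direction [l] separating [x] from [H] separates it in particular from [support_point l], where
    the support value is attained. *)
Lemma ellipsoid_sum_exterior_direction x :
  (0 < n)%N -> ~ H x -> exists2 l, enorm l = 1 & support l < dotprod l x.
Proof.
move=> n_gt0 Hx.
have H0 : H !=set0.
  (* Any nonzero direction yields a point of [H]; the all-ones vector is nonzero because [n] is
     positive. *)
  have e0 : const_mx 1 != 0 :> 'cV[R]_n.
    apply/eqP => /matrixP/(_ (Ordinal n_gt0) 0).
    by rewrite !mxE => /eqP; rewrite oner_eq0.
  by exists (support_point (const_mx 1)); exact: ellipsoid_sum_support_point.
have [l l1 sep] := separating_direction H x H0 ellipsoid_sum_compact
  ellipsoid_sum_convex Hx.
exists l => //; have l0 := enorm1_neq0 _ l1.
by rewrite -dotprod_support_point // sep //; exact: ellipsoid_sum_support_point.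
Qed.

Lemma support_continuous : continuous (fun l => support l).
Proof.
apply: sumr_continuous => i l.
apply: (@continuous_comp _ _ _ (fun l => dotprod l (Q i *m l)) Num.sqrt).
  exact: quadform_continuous.
exact: sqrt_continuous.
Qed.

Lemma ellipsoid_sum_interior x : (0 < n)%N ->
  (forall l, enorm l = 1 -> dotprod l x < support l) -> interior H x.
Proof.
move=> n_gt0 x_lt.
have S0 : [set u : 'cV[R]_n | enorm u = 1] !=set0.
  exists (delta_mx (Ordinal n_gt0) 0); apply/enorm1_sqnorm.
  by rewrite dotprod_delta mxE !eqxx.
have [|l0 /set_mem/= /x_lt gap_gt0 l0_min] :=
    @compact_EVT_min _ R (fun l : 'cV[R]_n => support l - dotprod l x) _
      S0 sphere_compact.
  apply: continuous_subspaceT => l.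
  apply: (cvgB (support_continuous l)).
  apply: (dotprod_continuous _ id (fun=> x)) => y; first exact: cvg_id.
  exact: cst_continuous.
set c := support l0 - _ in l0_min.
have c_gt0 : 0 < c by rewrite subr_gt0.
have cn_gt0 : 0 < c / n%:R by rewrite divr_gt0 // ltr0n.
(* Balls are taken in the maximum norm: each of the [n] terms of [dotprod l (z - x)] is at most
   [c / n], since unit vectors have entries of modulus at most 1. The total stays within the gap
   [c]. *)
apply/nbhs_ballP; exists (c / n%:R) => //= z [_ xz].
apply: contrapT => /(ellipsoid_sum_exterior_direction _ n_gt0)[l l1].
apply/negP; rewrite -leNgt.
have /mem_set/l0_min/= : [set u : 'cV[R]_n | enorm u = 1] l by [].
suff : dotprod l (z - x) <= c by rewrite dotprodBr; lra.
have -> : c = \sum_(i < n) c / n%:R.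
  by rewrite sumr_const card_ord -[RHS]mulr_natr divfK // pnatr_eq0 -lt0n.
apply: ler_sum => i _; apply: (le_trans (ler_norm _)); rewrite normrM.
rewrite -[leRHS]mul1r ler_pM // ?enorm1_coord_le //.
by rewrite !mxE distrC ltW //; exact: xz.
Qed.

(** A small step along [l] from the support point raises the inner product with [l] above its
    maximum on [H]. *)
Lemma support_point_not_interior l : enorm l = 1 ->
  ~ interior H (support_point l).
Proof.
move=> l1 /nbhs_ballP[e /= e_gt0 eH]; have l0 := enorm1_neq0 _ l1.
pose z := support_point l + (e / 2) *: l.
have Hz : H z.
  apply: eH; split => // i j; rewrite ord1 /ball /= !mxE opprD addNKr normrN.
  rewrite normrM gtr0_norm ?divr_gt0 //.
  (* Entries of [l] have modulus at most 1, so each coordinate moves by at most [e / 2 < e]. *)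
  have := enorm1_coord_le _ i l1; move: e_gt0; nra.
have := (ellipsoid_sum_support l z l0 Hz).1.
move/enorm1_sqnorm: l1 => l1.
rewrite dotprodDr dotprodZr l1 dotprod_support_point //.
by move: e_gt0; lra.
Qed.

End EllipsoidSum.

Theorem theorem1 (R : realType) (n k : nat) (hn : (0 < n)%N) (hk : (0 < k)%N)
    (Q : 'I_k -> 'M[R]_n) (hQ : forall i : 'I_k, symposdef (Q i)) :
  boundary (minkowski_sum (fun i : 'I_k => ellipsoid (Q i))) =
  [set x : 'cV[R]_n | exists2 l : 'cV[R]_n, enorm l = 1 &
     x = \sum_(i < k) (dotprod l (Q i *m l) `^ (- 2^-1)) *: (Q i *m l)].
Proof.
apply/seteqP; split => [x [clHx intHx] | _ [l l1 ->]]; last first.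
  rewrite -support_pointE //; split; last exact: support_point_not_interior.
  by apply: subset_closure; apply: ellipsoid_sum_support_point => //; exact: enorm1_neq0.
(* A compact set in a Hausdorff space is closed, so the closure point [x] belongs to the sum. *)
have Hx : minkowski_sum (fun i => ellipsoid (Q i)) x.
  apply: compact_closed clHx; last exact: ellipsoid_sum_compact.
  exact: norm_hausdorff.
apply: contrapT => no_l; apply: intHx; apply: ellipsoid_sum_interior => // l l1.
(* The support bound is strict at [x]: equality would make [x] the support point of [l], which
   [no_l] excludes. *)
have [le_s eq_s] := ellipsoid_sum_support hQ l x (enorm1_neq0 _ l1) Hx.
rewrite lt_neqAle le_s andbT eq_s; apply/eqP => xl.
by apply: no_l; exists l => //; rewrite -support_pointE.
Qed.
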